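(* Let $X$ be a Banach space. A maximal monotone multifunction $T:X\rightrightarrows X^*$ is regular if and only if $T+\partial g_{\lambda,x}$ is maximal monotone for every $x\in X$ and every $\lambda>0$, where $g_{\lambda,x}(z)=\lambda\|z-x\|$ for $z\in X$.
   Context: $X$ is a (real) Banach space with topological dual $X^*$ and $\langle x^*,x\rangle=\langle x,x^*\rangle$ denotes the evaluation pairing. For a multifunction $T:X\rightrightarrows X^*$, its graph is $G(T)=\{(x,x^* )\in X\times X^*: x^*\in T(x)\}$. $T$ is monotone if $\langle x^*-y^*,x-y\rangle\ge 0$ for all $(x,x^* ),(y,y^* )\in G(T)$; it is maximal monotone if it is monotone and there is no monotone multifunction $S:X\rightrightarrows X^*$ whose graph strictly contains $G(T)$. The sum of multifunctions is pointwise: $(T+S)(x)=\{x^*+u^*: x^*\in T(x),\ u^*\in S(x)\}$. $\partial g$ denotes the convex subdifferential of $g$; explicitly, $\partial g_{\lambda,x}(z)=\{z^*\in X^*:\|z^*\|\le\lambda \text{ and } \langle z^*,z-x\rangle=\lambda\|z-x\|\}$. For $(x,x^* )\in X\times X^*$ put $$L(x,x^*,T)=\max\left\{0,\ \sup\left\{\frac{\langle x^*-y^*,y-x\rangle}{\|x-y\|}: (y,y^* )\in G(T),\ y\neq x\right\}\right\}\in[0,\infty],$$ and $d(x^*,T(x))=\inf\{\|y^*-x^*\|: y^*\in T(x)\}$, with $d(x^*,\emptyset)=\infty$. A maximal monotone multifunction $T$ is called regular if $L(x,x^*,T)=d(x^*,T(x))$ for every $(x,x^* )\in X\times X^*$.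 *)

(* Defs.v *)
From HB Require Import structures.
From mathcomp Require Import all_boot all_order all_algebra.
From mathcomp Require Import boolp classical_sets functions reals ereal.
From mathcomp Require Import topology normedtype.

Set Implicit Arguments.
Unset Strict Implicit.
Unset Printing Implicit Defensive.

Import Order.TTheory GRing.Theory Num.Def Num.Theory.
Import numFieldNormedType.Exports.

Local Open Scope classical_set_scope.
Local Open Scope ring_scope.

Section dual_space.
Variables (R : realType) (X : normedModType R).

Definition continuous_linear : {pred X -> R^o} :=
  fun f => `[< linear f /\ continuous f >].

Fact continuous_linear_submod : submod_closed continuous_linear.
Proof.
split=> [|a f g /asboolP[lf cf] /asboolP[lg cg]]; apply/asboolP; split.
- by move=> b u v; rewrite scaler0 addr0.
- by move=> x; exact: cst_continuous.
- move=> b u v.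
  rewrite -[LHS]/(a *: f (b *: u + v) + g (b *: u + v)) lf lg.
  rewrite -[RHS]/(b *: (a *: f u + g u) + (a *: f v + g v)).
  by rewrite !scalerDr !scalerA (mulrC b a) addrACA.
- move=> x; apply: (@cvgD _ R^o _ _ _ (a *: f)); last exact: cg.
  by apply: cvgZl_tmp; exact: cf.
Qed.

HB.instance Definition _ := GRing.isSubmodClosed.Build R (X -> R^o)
  continuous_linear continuous_linear_submod.

Record dual := Dual {
  dual_fun : X -> R^o ;
  dual_funP : dual_fun \in continuous_linear }.

HB.instance Definition _ := [isSub for dual_fun].
HB.instance Definition _ := [Choice of dual by <:].
HB.instance Definition _ := [SubChoice_isSubLmodule of dual by <:].

(* R^o carries the module structure, but pairings are taken in R. *)
Definition pairing (f : dual) (x : X) : R := dual_fun f x.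

Local Notation "'<< f , x >>" := (pairing f x).

Lemma pairingP (f g : dual) : (forall x, '<< f, x >> = '<< g, x >>) -> f = g.
Proof. by move=> fg; apply: val_inj; apply/funext => x; exact: fg. Qed.

Lemma pairing_linear (f : dual) (a : R) (x y : X) :
  '<< f, a *: x + y >> = a * '<< f, x >> + '<< f, y >>.
Proof. by have /asboolP[lf _] := dual_funP f; exact: lf. Qed.

Lemma pairing_continuous (f : dual) : continuous (pairing f).
Proof. by have /asboolP[_ cf] := dual_funP f; exact: cf. Qed.

Lemma pairing0r (f : dual) : '<< f, 0 >> = 0.
Proof.
have := pairing_linear f 1 0 0; rewrite scale1r addr0 mul1r => /eqP.
by rewrite -subr_eq subrr eq_sym => /eqP.
Qed.

Lemma pairingZr (f : dual) a x : '<< f, a *: x >> = a * '<< f, x >>.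
Proof. by rewrite -[a *: x]addr0 pairing_linear pairing0r addr0. Qed.

Lemma pairingDr (f : dual) x y : '<< f, x + y >> = '<< f, x >> + '<< f, y >>.
Proof. by rewrite -[x in LHS]scale1r pairing_linear mul1r. Qed.

Lemma pairingNr (f : dual) x : '<< f, - x >> = - '<< f, x >>.
Proof. by rewrite -scaleN1r pairingZr mulN1r. Qed.

Lemma pairingBr (f : dual) x y : '<< f, x - y >> = '<< f, x >> - '<< f, y >>.
Proof. by rewrite pairingDr pairingNr. Qed.

Lemma pairingDl (f g : dual) x : '<< f + g, x >> = '<< f, x >> + '<< g, x >>.
Proof. by []. Qed.

Lemma pairingZl a (f : dual) x : '<< a *: f, x >> = a * '<< f, x >>.
Proof. by []. Qed.

Lemma pairing0l x : '<< 0, x >> = 0.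
Proof. by []. Qed.

Lemma pairingNl (f : dual) x : '<< - f, x >> = - '<< f, x >>.
Proof. by []. Qed.

Lemma pairingBl (f g : dual) x : '<< f - g, x >> = '<< f, x >> - '<< g, x >>.
Proof. by []. Qed.

Definition dual_norm (f : dual) : R :=
  sup [set `|'<< f, x >>| | x in [set x : X | `|x| <= 1]].

Lemma dual_norm_has_sup (f : dual) :
  has_sup [set `|'<< f, x >>| | x in [set x : X | `|x| <= 1]].
Proof.
split; first by exists `|'<< f, 0 >>|, 0 => //=; rewrite normr0 ler01.
have : '<< f, y >> @[y --> (0 : X)] --> (0 : R).
  by rewrite -[X in _ --> X](pairing0r f); exact: pairing_continuous.
move=> /cvgr0Pnorm_lt /(_ 1 ltr01) /nbhs_norm0P[e /= e0 fe].
exists (2 / e) => _ [x /= x1 <-].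
have e20 : 0 < e / 2 by rewrite divr_gt0.
have : `|'<< f, (e / 2) *: x >>| < 1.
  apply: fe => /=; rewrite normrZ gtr0_norm//.
  rewrite (@le_lt_trans _ _ (e / 2))// ?ler_piMr ?(ltW e20)//.
  by rewrite ltr_pdivrMr// ltr_pMr// ltr1n.
rewrite pairingZr normrM gtr0_norm// -ltr_pdivlMl// mulr1 invf_div.
exact: ltW.
Qed.

Lemma dual_norm_ge0 (f : dual) : 0 <= dual_norm f.
Proof.
apply: le_trans (sup_upper_bound (dual_norm_has_sup f) _); last first.
  by exists 0 => //=; rewrite normr0 ler01.
exact: normr_ge0.
Qed.

Lemma ler_pairing (f : dual) x : `|'<< f, x >>| <= dual_norm f * `|x|.
Proof.
have [->|x0] := eqVneq x 0; first by rewrite pairing0r !normr0 mulr0.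
have nx0 : 0 < `|x| by rewrite normr_gt0.
rewrite -ler_pdivrMr// mulrC -[`|x|^-1]gtr0_norm ?invr_gt0// -normrM -pairingZr.
apply: (sup_upper_bound (dual_norm_has_sup f)).
by exists (`|x|^-1 *: x) => //=; rewrite normrZ normfV normr_id mulVf// gt_eqF.
Qed.

Lemma dual_norm_le (f : dual) (a : R) : 0 <= a ->
  (forall x, `|'<< f, x >>| <= a * `|x|) -> dual_norm f <= a.
Proof.
move=> a0 fa; apply: ge_sup; first by have [] := dual_norm_has_sup f.
by move=> _ [x /= x1 <-]; rewrite (le_trans (fa x))// ler_piMr.
Qed.

Fact dual_norm_triangle (f g : dual) :
  dual_norm (f + g) <= dual_norm f + dual_norm g.
Proof.
apply: dual_norm_le => [|x]; first by rewrite addr_ge0 ?dual_norm_ge0.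
by rewrite pairingDl mulrDl (le_trans (ler_normD _ _))// lerD// ler_pairing.
Qed.

Fact dual_normZ (a : R) (f : dual) : dual_norm (a *: f) = `|a| * dual_norm f.
Proof.
have le b g : dual_norm (b *: g) <= `|b| * dual_norm g.
  apply: dual_norm_le => [|x]; first by rewrite mulr_ge0 ?dual_norm_ge0.
  by rewrite pairingZl normrM -mulrA ler_wpM2l// ler_pairing.
apply/eqP; rewrite eq_le le /=.
have [->|a0] := eqVneq a 0; first by rewrite normr0 mul0r dual_norm_ge0.
rewrite -ler_pdivlMl ?normr_gt0// -normfV.
by apply: le_trans (le _ _); rewrite scalerA mulVf// scale1r.
Qed.

Fact dual_norm_eq0 (f : dual) : dual_norm f = 0 -> f = 0.
Proof.
move=> f0; apply: pairingP => x; apply/eqP; rewrite -normr_le0.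
by rewrite (le_trans (ler_pairing f x))// f0 mul0r.
Qed.

HB.instance Definition _ := @Lmodule_isNormed.Build R dual
  dual_norm dual_norm_triangle dual_normZ dual_norm_eq0.

Lemma dual_normE (f : dual) : `|f| = dual_norm f.
Proof. by []. Qed.

End dual_space.

Notation "'<< f , x >>" := (pairing f x) : ring_scope.

Section multifunctions.
Variables (R : realType) (X : normedModType R).
Implicit Types (T S : X -> set (dual X)) (x : X) (xs : dual X).

Definition mf_graph T : set (X * dual X) := [set p | T p.1 p.2].

Definition monotone_mf T : Prop :=
  forall p q, mf_graph T p -> mf_graph T q -> 0 <= '<< p.2 - q.2, p.1 - q.1 >>.

Definition maximal_monotone T : Prop :=
  monotone_mf T /\ ~ exists S, monotone_mf S /\ mf_graph T `<` mf_graph S.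

Definition mf_add T S : X -> set (dual X) :=
  fun x => [set xs + us | xs in T x & us in S x].

Definition subdifferential (g : X -> R) : X -> set (dual X) :=
  fun z => [set zs | forall w, g z + '<< zs, w - z >> <= g w].

Definition scaled_dist (lambda : R) x : X -> R := fun z => lambda * `|z - x|.

Lemma subdifferential_scaled_distE (lambda : R) x z : 0 < lambda ->
  subdifferential (scaled_dist lambda x) z =
  [set zs | `|zs| <= lambda /\ '<< zs, z - x >> = lambda * `|z - x|].
Proof.
move=> l0; apply/seteqP; split=> zs /=.
  move=> h.
  have le y : '<< zs, y >> <= lambda * `|y|.
    have := h (z + y); rewrite addrAC subrr add0r /scaled_dist -lerBrDl.
    move=> /le_trans; apply; rewrite -mulrBr ler_wpM2l ?(ltW l0)//.
    by rewrite lerBlDr addrAC addrC ler_normD.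
  split.
    rewrite dual_normE; apply: dual_norm_le => [|y]; first exact: ltW.
    by rewrite ler_norml le andbT lerNl -pairingNr -(normrN y) le.
  apply/eqP; rewrite eq_le le /=.
  have := h x; rewrite /scaled_dist subrr normr0 mulr0.
  by rewrite -(opprB z x) pairingNr subr_le0.
move=> [zl e] w; rewrite /scaled_dist -e -pairingDr addrC addrA subrK.
apply: (le_trans (ler_norm _)); apply: (le_trans (ler_pairing _ _)).
by rewrite ler_wpM2r// -dual_normE.
Qed.

Local Open Scope ereal_scope.

(* ereal_sup set0 = -oo, so the value is 0 when no such point exists. *)
Definition L_mf x xs T : \bar R :=
  maxe 0 (ereal_sup
    [set (('<< xs - p.2, p.1 - x >> / `|x - p.1|)%R)%:E
    | p in [set p | mf_graph T p /\ p.1 <> x]]).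

(* ereal_inf set0 = +oo *)
Definition dist_dual xs (A : set (dual X)) : \bar R :=
  ereal_inf [set `|ys - xs|%:E | ys in A].

Definition regular_mf T : Prop :=
  forall x xs, L_mf x xs T = dist_dual xs (T x).

End multifunctions.

(* Main.v *)
(** One direction is direct: if lambda > L(x, xs, T) then (x, xs) is
monotonically related to T + dg_{lambda,x}, so xs lies within lambda of T(x).

Conversely, let g = g_{lambda,x0} and let (x, xs) be monotonically related to
T + dg; translate so that (x, xs) = (0, 0). Of regularity only this is used:
if L(c, cs, T) is finite, T(c) is nonempty. Applied at 0 it gives as0 in T(0).
Let (y, ys, q) be in the epigraph of the Fitzpatrick function of T, a convex
set, and put c = s y and cs = s ys + (1 - s) as0 for small s. Applied at (c,
cs), it provides pairs (b, bs) of the graph of T with b arbitrarily close to c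
and <bs - cs, b - c> <= 0. Since (0, 0) is related to T + dg at b, letting s
tend to 0 gives g(0) <= g(y) + q. By Hahn-Banach there is a single zs in dg(0)
with <zs, y> + q >= 0 for all those (y, q), in particular with <zs + ys, y> >=
0 for all (y, ys) in the graph of T. Hence -zs is in T(0) by maximality, and 0
= -zs + zs is in (T + dg)(0). *)

Require Import Defs.
From mathcomp Require Import all_boot all_order all_algebra.
From mathcomp Require Import boolp classical_sets reals topology normedtype.
From mathcomp Require Import ereal ring lra.

Set Implicit Arguments.
Unset Strict Implicit.
Unset Printing Implicit Defensive.

Import Order.TTheory GRing.Theory Num.Theory.
Import numFieldNormedType.Exports.

Local Open Scope classical_set_scope.
Local Open Scope ring_scope.

(** * The Hahn-Banach theorem from minimal sublinear functionals *)

Section hahn_banach.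
Variables (R : realType) (V : lmodType R).

Definition sublinear (p : V -> R) : Prop :=
  (forall t v, 0 < t -> p (t *: v) <= t * p v) /\
  (forall u v, p (u + v) <= p u + p v).

Lemma sublinearZ p t v : sublinear p -> 0 < t -> p (t *: v) = t * p v.
Proof.
move=> [pZ _] t0; apply/le_anti/andP; split; first exact: pZ.
rewrite -ler_pdivlMl// (le_trans _ (pZ _ _ _)) ?invr_gt0//.
by rewrite scalerA mulVf ?gt_eqF// scale1r.
Qed.

Lemma sublinear0 p : sublinear p -> p 0 = 0.
Proof.
move=> sp; have := @sublinearZ p 2 0 sp (ltr0n _ 2); rewrite scaler0.
by move=> h; lra.
Qed.

Lemma sublinear_geN p v : sublinear p -> - p (- v) <= p v.
Proof.
move=> sp; have [_ /(_ v (- v))] := sp.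
by rewrite subrr sublinear0// => h; lra.
Qed.

(** Two members [a] and [b] of the chain are comparable, so the smaller one at [u + v] is at most
    [a u + b v]; hence the infimum is subadditive. The bound [- p (- v)] keeps it finite. *)
Lemma sublinear_inf_chain (A : set (V -> R)) (p : V -> R) :
  A !=set0 -> (forall a, A a -> sublinear a /\ forall v, a v <= p v) ->
  (forall a b, A a -> A b -> (forall v, a v <= b v) \/ forall v, b v <= a v) ->
  sublinear (fun v => inf [set a v | a in A]) /\
  (forall a, A a -> forall v, inf [set b v | b in A] <= a v).
Proof.
move=> [a0 Aa0] Ap Atot.
have lbA v : has_lbound [set a v | a in A].
  exists (- p (- v)) => _ [a /Ap[sa ap] <-].
  by apply: (le_trans _ (sublinear_geN _ sa)); rewrite lerN2.
have le a : A a -> forall v, inf [set b v | b in A] <= a v.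
  by move=> Aa v; apply: ge_inf => //; exists a.
have ge v r : (forall a, A a -> r <= a v) -> r <= inf [set a v | a in A].
  move=> h; apply: lb_le_inf; first by exists (a0 v), a0.
  by move=> _ [a Aa <-]; exact: h.
split=> //; split=> [t v t0|u v].
  rewrite -ler_pdivrMl//; apply: (ge) => a Aa.
  rewrite ler_pdivrMl// -sublinearZ//; last by have [] := Ap a Aa.
  exact: le.
rewrite -lerBlDr; apply: (ge) => a Aa; rewrite lerBlDr -lerBlDl.
apply: (ge) => b Ab; rewrite lerBlDl.
have [ab|ba] := Atot a b Aa Ab.
  apply: (le_trans (le a Aa _)); have [[_ /(_ u v) h] _] := Ap a Aa.
  by have := ab v; lra.
apply: (le_trans (le b Ab _)); have [[_ /(_ u v) h] _] := Ap b Ab.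
by have := ba u; lra.
Qed.

(* Lowering p along the line spanned by x keeps it sublinear and forces the
   value - p x at - x; hence a minimal sublinear functional is odd. *)
Lemma sublinear_lower p x : sublinear p -> exists2 q, sublinear q &
  (forall v, q v <= p v) /\ q (- x) <= - p x.
Proof.
move=> sp.
pose E v := [set p (v + t *: x) - t * p x | t in [set t : R | 0 <= t]].
have pZ t y : 0 <= t -> p (t *: y) = t * p y.
  rewrite le_eqVlt => /orP[/eqP <-|t0]; last exact: sublinearZ.
  by rewrite scale0r mul0r sublinear0.
have lbE v : has_lbound (E v).
  exists (- p (- v)) => _ [t /= t0 <-].
  have [_ /(_ (v + t *: x) (- v))] := sp.
  by rewrite addrAC subrr add0r pZ// => h; lra.
have le v t : 0 <= t -> inf (E v) <= p (v + t *: x) - t * p x.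
  by move=> t0; apply: ge_inf => //; exists t.
have ge v r : (forall t, 0 <= t -> r <= p (v + t *: x) - t * p x) ->
    r <= inf (E v).
  move=> h; apply: lb_le_inf.
    by exists (p (v + 0 *: x) - 0 * p x), 0 => /=.
  by move=> _ [t /= t0 <-]; exact: h.
exists (fun v => inf (E v)); split.
- move=> t v t0; rewrite -ler_pdivrMl//; apply: (ge) => s s0.
  rewrite ler_pdivrMl//; apply: (le_trans (le _ (t * s) _)).
    by rewrite mulr_ge0// ltW.
  by rewrite -scalerA -scalerDr sublinearZ// mulrBr mulrA.
- move=> u v; rewrite -lerBlDr; apply: (ge) => s s0.
  rewrite lerBlDr -lerBlDl; apply: (ge) => t t0; rewrite lerBlDl.
  apply: (le_trans (le _ (s + t) _)); first exact: addr_ge0.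
  rewrite scalerDl addrACA; have [_ /(_ (u + s *: x) (v + t *: x)) h] := sp.
  by lra.
- by move=> v; have := le v 0 (lexx _); rewrite scale0r addr0 mul0r subr0.
- by have := le (- x) 1 ler01; rewrite scale1r addNr sublinear0// mul1r sub0r.
Qed.

Theorem hahn_banach p : sublinear p ->
  exists2 f : V -> R, (forall a u v, f (a *: u + v) = a * f u + f v) &
    forall v, f v <= p v.
Proof.
move=> sp; pose D := {q : V -> R | sublinear q /\ forall v, q v <= p v}.
(* The order is reversed, so that a maximal element given by Zorn's lemma is a minimal
   functional. *)
pose rel_D (a b : D) := `[< forall v, sval b v <= sval a v >].
have [||||[f [sf fp]] fmin] := @Zorn D rel_D.
- by move=> a; apply/asboolP.
- move=> a b c /asboolP ab /asboolP bc; apply/asboolP => v.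
  exact: le_trans (bc v) (ab v).
- move=> [a ha] [b hb] /asboolP /= ab /asboolP /= ba; apply: eq_exist.
  by apply/funext => v; apply/le_anti; rewrite ab ba.
- move=> A Atot; have [A0|/set0P/negP/negPn/eqP A0] := pselect (A !=set0);
    last first.
    by exists (exist _ p (conj sp (fun v => lexx _))) => s; rewrite A0.
  have [||a b|si le_inf] := @sublinear_inf_chain [set sval a | a in A] p.
  + by have [a Aa] := A0; exists (sval a), a.
  + by move=> _ [[a ha] _ <-].
  + move=> [a' Aa' <-] [b' Ab' <-].
    by have [/asboolP ab|/asboolP ba] := Atot _ _ Aa' Ab'; [right|left].
  + have ip v : inf [set b v | b in [set sval a | a in A]] <= p v.
      have [a Aa] := A0; apply: (le_trans (le_inf (sval a) _ v)).
        by exists a.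
      by have [_] := proj2_sig a.
    pose i : D := exist _ (fun v => _) (conj si ip).
    exists i => a Aa; apply/asboolP => v /=.
    by apply: le_inf; exists a.
(* Minimality identifies [f] with its lowering [q] along [x], whence [f (- x) <= - f x]. Oddness
   then turns subadditivity into additivity. *)
have fN x : f (- x) = - f x.
  have [q sq [qf qx]] := sublinear_lower x sf.
  have qp v : q v <= p v by exact: le_trans (qf v) (fp v).
  have /(congr1 sval) /= qE := fmin (exist _ q (conj sq qp)) (asboolT qf).
  rewrite qE in qx; apply/le_anti; rewrite qx /=.
  by have := sublinear_geN x sf; lra.
have fD u v : f (u + v) = f u + f v.
  apply/le_anti; have [_ fD] := sf; rewrite fD /=.
  have := fD (u + v) (- v); rewrite addrK fN; lra.
exists f => // a u v; rewrite fD; congr (_ + _).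
have [a0|a0|->] := ltgtP a 0.
- rewrite -[a *: u]opprK -scaleNr fN sublinearZ ?oppr_gt0//; lra.
- exact: sublinearZ.
- by rewrite scale0r mul0r sublinear0.
Qed.

End hahn_banach.

(** * Subgradients of convex Lipschitz functions *)

Section subgradients.
Variables (R : realType) (X : normedModType R).
Implicit Types (g : X -> R) (K : X -> R -> Prop).

Definition convex_fun g : Prop := forall t u v, 0 <= t <= 1 ->
  g (t *: u + (1 - t) *: v) <= t * g u + (1 - t) * g v.

Definition lipschitz_fun (lambda : R) g : Prop :=
  forall u v, g u - g v <= lambda * `|u - v|.

Definition convex_rel K : Prop := forall t y q y' q', 0 <= t <= 1 ->
  K y q -> K y' q' -> K (t *: y + (1 - t) *: y') (t * q + (1 - t) * q').

Lemma bounded_linear_dual (f : X -> R) (lambda : R) :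
  (forall a u v, f (a *: u + v) = a * f u + f v) ->
  (forall v, f v <= lambda * `|v|) ->
  exists fs : dual X, forall v, '<< fs, v >> = f v.
Proof.
move=> lf fl; have f0 : f 0 = 0.
  by have := lf 1 0 0; rewrite scale1r addr0 mul1r => h; lra.
have fB u v : f (u - v) = f u - f v.
  by have := lf (-1) v u; rewrite scaleN1r addrC => ->; rewrite mulN1r addrC.
have fabs v : `|f v| <= lambda * `|v|.
  rewrite ler_norml fl andbT lerNl.
  by have := fl (- v); rewrite normrN -[- v]sub0r fB f0 sub0r.
have fP : (f : X -> R^o) \in @continuous_linear R X.
  apply/asboolP; split; first exact: lf.
  move=> x; apply/(@cvgrPdist_lt R R^o) => e e0.
  (* As [lambda] may vanish, 1 is added to obtain a positive divisor. *)
  have l0 : 0 < `|lambda| + 1 by rewrite ltr_wpDl.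
  near=> y; rewrite -fB; apply: (le_lt_trans (fabs _)).
  apply: (@le_lt_trans _ _ ((`|lambda| + 1) * `|x - y|)).
    by rewrite ler_wpM2r// (le_trans (ler_norm _))// lerDl.
  rewrite -ltr_pdivlMl//; near: y.
  by apply: cvgr_dist_lt => //; rewrite mulr_gt0// invr_gt0.
by exists (Dual fP).
Unshelve. all: by end_near. Qed.

(* Hahn-Banach applied to the infimum over s > 0 and K y q of
   (g (x + (s v + y)) - g x + q) / s: taking y = q = 0 bounds it by the
   difference quotients of g at x, and taking v = - y bounds it by q. *)
Theorem subgradient_above g (lambda : R) x K :
  convex_fun g -> lipschitz_fun lambda g -> convex_rel K -> K 0 0 ->
  (forall y q, K y q -> g x <= g (x + y) + q) ->
  exists2 zs : dual X, subdifferential g x zs &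
    forall y q, K y q -> 0 <= '<< zs, y >> + q.
Proof.
move=> cg lg cK K0 Kg.
pose h s v y q := (g (x + (s *: v + y)) - g x + q) / s.
pose E v := [set r | exists s y q, [/\ 0 < s, K y q & r = h s v y q]].
(* [Kg] bounds [g x] by [g (x + y) + q], and passing from [x + y] to [x + (s *: v + y)] costs at
   most [lambda * s * |v|]. *)
have lb v s y q : 0 < s -> K y q -> - (lambda * `|v|) <= h s v y q.
  move=> s0 Kyq; rewrite ler_pdivlMr// mulNr mulrAC -mulrA -[s]gtr0_norm//.
  rewrite -normrZ gtr0_norm//.
  have := lg (x + y) (x + (s *: v + y)); have := Kg _ _ Kyq.
  have -> : x + y - (x + (s *: v + y)) = - (s *: v).
    by rewrite opprD addrACA subrr add0r opprD addrC subrK.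
  rewrite normrN.
  by move=> ? ?; lra.
have lbE v : has_lbound (E v).
  by exists (- (lambda * `|v|)) => _ [s [y [q [s0 Kyq ->]]]]; exact: lb.
have le v s y q : 0 < s -> K y q -> inf (E v) <= h s v y q.
  by move=> s0 Kyq; apply: ge_inf => //; exists s, y, q.
have ge v r : (forall s y q, 0 < s -> K y q -> r <= h s v y q) ->
    r <= inf (E v).
  move=> rh; apply: lb_le_inf; first by exists (h 1 v 0 0), 1, 0, 0.
  by move=> _ [s [y [q [s0 Kyq ->]]]]; exact: rh.
have [|f lf fle] := @hahn_banach R X (fun v => inf (E v)).
  split=> [t v t0|u v].
    rewrite -ler_pdivrMl//; apply: (ge) => s y q s0 Kyq; rewrite ler_pdivrMl//.
    apply: (le_trans (le _ (s / t) _ _ _ Kyq)); first by rewrite divr_gt0.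
    rewrite /h scalerA divfK ?gt_eqF// invf_div mulrCA !mulrA.
    by rewrite (mulrC t).
  rewrite -lerBlDr; apply: (ge) => s y q s0 Kyq; rewrite lerBlDr -lerBlDl.
  apply: (ge) => s' y' q' s'0 Kyq'; rewrite lerBlDl.
  have ss0 : 0 < s + s' by rewrite addr_gt0.
  (* With this weight [t * s = (1 - t) * s'], so [u] and [v] receive a common coefficient in the
     convex combination. *)
  pose t := s' / (s + s').
  have t01 : 0 <= t <= 1.
    rewrite divr_ge0 ?(ltW s'0) ?(ltW ss0)//= ler_pdivrMr// mul1r.
    by rewrite lerDr ltW.
  have := cg t (x + (s *: u + y)) (x + (s' *: v + y')) t01.
  have -> : t *: (x + (s *: u + y)) + (1 - t) *: (x + (s' *: v + y')) =
      x + ((s * s' / (s + s')) *: (u + v) + (t *: y + (1 - t) *: y')).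
    have e1 : t * s = s * s' / (s + s') by rewrite /t; field; rewrite gt_eqF.
    have e2 : (1 - t) * s' = s * s' / (s + s').
      by rewrite /t; field; rewrite gt_eqF.
    rewrite !scalerDr !scalerA e1 e2 addrACA -scalerDl subrKC scale1r.
    by congr (x + _); rewrite addrACA.
  move=> hg; apply: (le_trans (le _ (s * s' / (s + s')) _ _ _
    (cK _ _ _ _ _ t01 Kyq Kyq'))); first by rewrite divr_gt0// mulr_gt0.
  rewrite /h ler_pdivrMr; last by rewrite divr_gt0// mulr_gt0.
  set A := g (x + (s *: u + y)) in hg *.
  set B := g (x + (s' *: v + y')) in hg *.
  have -> : ((A - g x + q) / s + (B - g x + q') / s') * (s * s' / (s + s')) =
      t * (A - g x + q) + (1 - t) * (B - g x + q').
    by rewrite /t; field; rewrite !gt_eqF.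
  by lra.
have f_le s y q v : 0 < s -> K y q -> f v <= h s v y q.
  by move=> s0 Kyq; exact: le_trans (fle v) (le _ _ _ _ s0 Kyq).
have fg v : f v <= g (x + v) - g x.
  by have := f_le 1 0 0 v ltr01 K0; rewrite /h scale1r !addr0 divr1.
have [|zs zsE] := @bounded_linear_dual f lambda lf.
  move=> v; apply: (le_trans (fg v)); apply: (le_trans (lg _ _)).
  by rewrite addrC addKr.
exists zs => [w|y q Kyq]; rewrite /= ?zsE.
  by have := fg (w - x); rewrite subrKC => ?; lra.
have := f_le 1 y q (- y) ltr01 Kyq.
rewrite /h scale1r addNr addr0 subrr add0r divr1 -zsE pairingNr zsE => ?.
by lra.
Qed.

(** Taking for [K] the single point (0, 0) leaves only the subgradient condition. *)
Lemma subdifferential_nonempty g (lambda : R) x :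
  convex_fun g -> lipschitz_fun lambda g -> subdifferential g x !=set0.
Proof.
move=> cg lg.
have [|//|y q [-> ->]|zs gzs _] :=
  @subgradient_above g lambda x (fun y q => y = 0 /\ q = 0) cg lg.
- move=> t y q y' q' _ [-> ->] [-> ->].
  by rewrite !scaler0 !mulr0 !addr0.
- by rewrite !addr0.
- by exists zs.
Qed.

Lemma convex_scaled_dist (lambda : R) x : 0 <= lambda ->
  convex_fun (scaled_dist lambda x).
Proof.
move=> l0 t u v /andP[t0 t1]; rewrite /scaled_dist.
have -> : t *: u + (1 - t) *: v - x = t *: (u - x) + (1 - t) *: (v - x).
  by rewrite !scalerBr addrACA -opprD -scalerDl subrKC scale1r.
rewrite 2!(mulrCA _ lambda) -mulrDr ler_wpM2l// (le_trans (ler_normD _ _))//.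
by rewrite !normrZ (ger0_norm t0) ger0_norm// subr_ge0.
Qed.

Lemma lipschitz_scaled_dist (lambda : R) x : 0 <= lambda ->
  lipschitz_fun lambda (scaled_dist lambda x).
Proof.
move=> l0 u v; rewrite /scaled_dist -mulrBr ler_wpM2l//.
by rewrite (le_trans (lerB_dist _ _))// opprB addrA subrK.
Qed.

Lemma lipschitz_subgradient_le g (lambda : R) x zs v : lipschitz_fun lambda g ->
  subdifferential g x zs -> '<< zs, v >> <= lambda * `|v|.
Proof.
move=> lg /(_ (x + v)) /=; have := lg (x + v) x.
by rewrite [x + v]addrC addrK => ? ?; lra.
Qed.

Lemma subdifferential_monotone g x y xs ys : subdifferential g x xs ->
  subdifferential g y ys -> 0 <= '<< xs - ys, x - y >>.
Proof.
move=> /(_ y) hx /(_ x) hy; rewrite pairingBl !pairingBr in hx hy *.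
by lra.
Qed.

End subgradients.

(** * Monotone relatedness, slopes, translation and the Fitzpatrick epigraph *)

Section multifunction_theory.
Variables (R : realType) (X : normedModType R).
Implicit Types (T : X -> set (dual X)) (x y : X) (xs ys : dual X).

Lemma pairingBB_swap (f g : dual X) (u v : X) :
  '<< f - g, u - v >> = '<< g - f, v - u >>.
Proof. by rewrite !pairingBl !pairingBr; ring. Qed.

Definition monotone_related x xs T : Prop :=
  forall y ys, T y ys -> 0 <= '<< ys - xs, y - x >>.

Lemma monotone_mfP T : monotone_mf T <-> forall y ys z zs,
  T y ys -> T z zs -> 0 <= '<< ys - zs, y - z >>.
Proof.
split=> [mT y ys z zs|mT [y ys] [z zs]]; last exact: mT.
exact: (mT (y, ys) (z, zs)).
Qed.

(** Adjoining a monotonically related point keeps the graph monotone, so maximality forces it to be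
    there already. Conversely, every point of a monotone extension is related to [T]. *)
Lemma maximal_monotoneP T : maximal_monotone T <->
  monotone_mf T /\ forall x xs, monotone_related x xs T -> T x xs.
Proof.
split=> [[/monotone_mfP mT maxT]|[mT relT]].
  split=> [|x xs xT]; first exact/monotone_mfP.
  apply: contrapT => nT; apply: maxT.
  exists (fun y => T y `|` [set ys | y = x /\ ys = xs]); split.
    apply/monotone_mfP => y ys z zs [Ty|[-> ->]] [Tz|[-> ->]].
    - exact: mT.
    - exact: xT.
    - by rewrite pairingBB_swap; exact: xT.
    - by rewrite !subrr pairing0r.
  split=> [[y ys] /= Ty|sub]; first by left.
  by apply: nT; apply: (sub (x, xs)); right.
split=> // -[S [/monotone_mfP mS [TS nST]]]; apply: nST => -[x xs] Sx.
apply: relT => y ys Ty.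
exact: mS (TS (y, ys) Ty) Sx.
Qed.

(** This is [L_mf x xs T <= C] cleared of denominators; the excluded point [y = x] now contributes
    [0 <= 0]. *)
Definition slope_bounded (C : R) x xs T : Prop :=
  forall y ys, T y ys -> '<< xs - ys, y - x >> <= C * `|y - x|.

Lemma L_mf_leP x xs T (C : R) : 0 <= C ->
  (L_mf x xs T <= C%:E)%E <-> slope_bounded C x xs T.
Proof.
move=> C0; split=> [LC y ys Ty|h].
  have [->|yx] := eqVneq y x; first by rewrite subrr pairing0r normr0 mulr0.
  rewrite -ler_pdivrMr ?normr_gt0 ?subr_eq0// -lee_fin.
  apply: le_trans LC; rewrite /L_mf le_max; apply/orP; right.
  apply: ereal_sup_ubound; exists (y, ys) => /=; last by rewrite distrC.
  by split=> //; exact/eqP.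
rewrite /L_mf ge_max lee_fin C0 /=.
apply: ge_ereal_sup => _ [[y ys] /= [Ty yx] <-].
rewrite lee_fin distrC ler_pdivrMr ?normr_gt0 ?subr_eq0; last exact/eqP.
exact: h.
Qed.

Lemma dist_dual_lt xs (A : set (dual X)) (e : \bar R) :
  (dist_dual xs A < e)%E -> exists2 ys, A ys & (`|ys - xs|%:E < e)%E.
Proof. by move=> /ereal_inf_lt[_ [ys Ays <-] h]; exists ys. Qed.

(** Regularity turns a finite [L_mf] into a finite distance, whereas the distance to the empty set
    is [+oo]. *)
Lemma regular_nonempty T x xs (C : R) : 0 <= C -> regular_mf T ->
  slope_bounded C x xs T -> T x !=set0.
Proof.
move=> C0 rT /(L_mf_leP _ _ _ C0) LC.
have [|ys Tys _] := @dist_dual_lt xs (T x) +oo%E; last by exists ys.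
by rewrite -rT (le_lt_trans LC)// ltry.
Qed.

(** For [zs] in [T x], monotonicity bounds [<xs - ys, y - x>] by [<xs - zs, y - x>], which is at
    most [|zs - xs| * |y - x|]. *)
Lemma L_mf_le_dist_dual T x xs : monotone_mf T ->
  (L_mf x xs T <= dist_dual xs (T x))%E.
Proof.
move=> /monotone_mfP mT; apply: le_ereal_inf_tmp => _ [zs Tz <-].
apply/L_mf_leP => // y ys Ty.
have := mT _ _ _ _ Ty Tz.
have := le_trans (ler_norm _) (ler_pairing (zs - xs) (- (y - x))).
rewrite -dual_normE normrN pairingNr !pairingBl => ? ?; lra.
Qed.

Definition shift_mf T x xs : X -> set (dual X) :=
  fun v => [set vs | T (x + v) (xs + vs)].

Lemma monotone_shift_mf T x xs : monotone_mf T -> monotone_mf (shift_mf T x xs).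
Proof.
move=> /monotone_mfP mT; apply/monotone_mfP => v vs w ws Tv Tw.
have := mT _ _ _ _ Tv Tw.
by rewrite !opprD !(addrACA _ v) !(addrACA _ vs) !subrr !add0r.
Qed.

Lemma regular_shift_mf_nonempty T x xs v vs (C : R) : 0 <= C -> regular_mf T ->
  slope_bounded C v vs (shift_mf T x xs) -> shift_mf T x xs v !=set0.
Proof.
move=> C0 rT h; have [|zs Tz] := @regular_nonempty T (x + v) (xs + vs) C C0 rT.
  move=> y ys Ty.
  have -> : y - (x + v) = y - x - v by rewrite opprD addrA.
  have -> : xs + vs - ys = vs - (ys - xs) by rewrite opprB addrA (addrC xs).
  by apply: h; rewrite /shift_mf /mkset !subrKC.
by exists (zs - xs); rewrite /shift_mf /mkset subrKC.
Qed.

(* (y, ys, q) lies in the epigraph of the Fitzpatrick function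
   sup {<ws, y> + <ys, w> - <ws, w> | ws \in T w}. *)
Definition fitzpatrick_epi T y (q : R) ys : Prop :=
  forall w ws, T w ws ->
    0 <= '<< ws, w >> - '<< ys, w >> - '<< ws, y >> + q.

(** For fixed [w] and [ws] the condition is affine in [(y, q, ys)]. *)
Lemma fitzpatrick_epi_convex T t y q ys y' q' ys' : 0 <= t <= 1 ->
  fitzpatrick_epi T y q ys -> fitzpatrick_epi T y' q' ys' ->
  fitzpatrick_epi T (t *: y + (1 - t) *: y') (t * q + (1 - t) * q')
    (t *: ys + (1 - t) *: ys').
Proof.
move=> /andP[t0 t1] h h' w ws Tw.
rewrite pairingDl !pairingZl pairingDr !pairingZr.
have := mulr_ge0 t0 (h w ws Tw).
have t1' : 0 <= 1 - t by rewrite subr_ge0.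
by have := mulr_ge0 t1' (h' w ws Tw) => ? ?; lra.
Qed.

(** With [q = <ys, y>] the condition is [0 <= <ws - ys, w - y>], expanded. *)
Lemma fitzpatrick_epi_graph T y ys : monotone_mf T -> T y ys ->
  fitzpatrick_epi T y '<< ys, y >> ys.
Proof.
move=> /monotone_mfP mT Ty w ws Tw; have := mT _ _ _ _ Tw Ty.
by rewrite pairingBl !pairingBr => ?; lra.
Qed.

(** * Graph points near a segment, and the bound that they give *)

Section near_segment.
Variables (T : X -> set (dual X)).
Hypothesis mT : monotone_mf T.
Hypothesis domT : forall (C : R) c cs, 0 <= C ->
  slope_bounded C c cs T -> T c !=set0.

(* Were there no such (b, bs), the slopes at (c, cs) would be at most
   |e| / eta, so c would lie in the domain of T and b := c would do. *)
Lemma graph_point_near c cs (e eta : R) : 0 < eta ->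
  (forall w ws, T w ws -> '<< cs - ws, w - c >> <= e) ->
  exists b bs, [/\ T b bs, `|b - c| <= eta & '<< bs - cs, b - c >> <= 0].
Proof.
move=> eta0 he; apply: contrapT => nex.
have [||bs Tc] := @domT (`|e| / eta) c cs.
- by rewrite divr_ge0// ltW.
- move=> w ws Tw; have [wc|wc] := leP `|w - c| eta.
    apply: (@le_trans _ _ 0); last by rewrite mulr_ge0// divr_ge0// ltW.
    rewrite leNgt; apply/negP => h; apply: nex; exists w, ws; split=> //.
    by rewrite pairingBl; rewrite pairingBl in h; lra.
  apply: (le_trans (he w ws Tw)); apply: (le_trans (ler_norm _)).
  by rewrite mulrAC ler_pdivlMr// ler_wpM2l// ltW.
- apply: nex; exists c, bs; rewrite subrr normr0 pairing0r.
  by split=> //; exact: ltW.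
Qed.

(** Supplies the domination hypothesis of [subgradient_above]. The limit [s -> 0] is made explicit
    through an error term [s * C]. *)
Lemma fitzpatrick_epi_bound (g : X -> R) (lambda : R) as0 y q ys :
  lipschitz_fun lambda g -> 0 <= lambda -> T 0 as0 ->
  (forall b bs, T b bs ->
    exists2 zs, subdifferential g b zs & 0 <= '<< bs + zs, b >>) ->
  fitzpatrick_epi T y q ys -> g 0 <= g y + q.
Proof.
move=> lg l0 T0 gT yT.
(* Coefficients of the errors of order [s ^+ 2]: [lambda * |y|] and one [lambda] from comparing
   [g b] with [g 0], the other [lambda] from [<zs, e>], then [<as0, e>] and [s ^+ 2 * <ys, y>]. *)
pose C := lambda * `|y| + 2 * lambda + `|as0| + `| '<< ys, y >>|.
have C0 : 0 <= C by rewrite !addr_ge0// !mulr_ge0.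
suff key (s : R) : 0 < s -> s < 1 -> 0 <= g y - g 0 + q + s * C.
  rewrite leNgt; apply/negP => gy.
  pose d := g 0 - (g y + q); have d0 : 0 < d by rewrite subr_gt0.
  (* This choice makes [s < 1] and [s * C < d], whereas [key] says [d <= s * C]. *)
  pose s := d / (2 * (d + C + 1)).
  have D0 : 0 < d + C + 1 by lra.
  have D20 : 0 < 2 * (d + C + 1) by lra.
  have s0 : 0 < s by rewrite divr_gt0.
  have s1 : s < 1 by rewrite /s ltr_pdivrMr//; lra.
  have sE : s * (2 * (d + C + 1)) = d by rewrite /s divfK// gt_eqF.
  have := key s s0 s1; rewrite /d in sE d0 *; nra.
move=> s0 s1.
pose c := s *: y; pose cs := s *: ys + (1 - s) *: as0.
have s1' : 0 < 1 - s by rewrite subr_gt0.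
(* The point [(c, s * q, cs)] is a convex combination of the epigraph points [(y, q, ys)] and
   [(0, 0, as0)], which yields the bound [s * q - <cs, c>]. The radius [s ^+ 2] leaves an error of
   order [s] after division by [s]. *)
have [|w ws Tw|b [bs [Tb]]] :=
    @graph_point_near c cs (s * q - '<< cs, c >>) (s ^+ 2).
- by rewrite exprn_gt0.
- have h1 := mulr_ge0 (ltW s0) (yT w ws Tw).
  have /monotone_mfP/(_ _ _ _ _ Tw T0)/(mulr_ge0 (ltW s1')) := mT.
  rewrite subr0 !pairingBl !pairingBr /c /cs => h2.
  rewrite !pairingDl !pairingZl !pairingZr in h1 h2 *.
  by lra.
pose e := b - c; have bE : b = s *: y + e by rewrite /e /c subrKC.
rewrite -/e => eta; rewrite pairingBl => hbe; clearbody e.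
have [zs gzs zb] := gT b bs Tb.
have hy := mulr_ge0 (ltW s0) (yT b bs Tb).
have hgy : '<< zs, y - b >> <= g y - g b by rewrite lerBrDl; exact: gzs.
have hze := lipschitz_subgradient_le e lg gzs.
have hgb : g 0 - g b <= lambda * (s * `|y| + `|e|).
  apply: (le_trans (lg _ _)); rewrite sub0r normrN ler_wpM2l// bE.
  by rewrite (le_trans (ler_normD _ _))// normrZ gtr0_norm.
have has : '<< as0, e >> <= `|as0| * `|e|.
  exact: le_trans (ler_norm _) (ler_pairing _ _).
have hys := ler_norm (- '<< ys, y >>); rewrite normrN in hys.
have e0 : 0 <= `|e| by [].
have a0 : 0 <= `|as0| by [].
(* The goal is multiplied by [s]. Since [s *: y = b - e], adding [hy] and [hzb] cancels [<bs, b>],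
   [hbe] removes [<bs, e>], and [hsgy] trades [(1 - s) * <zs, b>] for [s * (g y - g b)] up to
   [<zs, e>]. *)
rewrite -(pmulr_rge0 _ s0) /C; rewrite pairingBr in hgy.
move: (g b) hgy hgb => gb hgy hgb.
rewrite bE /cs !(pairingDl, pairingDr, pairingZl, pairingZr) in hy zb hgy hbe.
have hzb := mulr_ge0 (ltW s1') zb.
have hsgy := ler_wpM2l (ltW s0) hgy; have hsgb := ler_wpM2l (ltW s0) hgb.
have ss0 : 0 <= s ^+ 2 by rewrite exprn_ge0// ltW.
have hssys := ler_wpM2l ss0 hys.
have hsas := ler_wpM2l (ltW s1') has.
have hane := ler_wpM2l a0 eta; have hlne := ler_wpM2l l0 eta.
have hsane := mulr_ge0 (ltW s0) (mulr_ge0 a0 e0).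
have hslne := mulr_ge0 (ltW s1') (mulr_ge0 l0 e0).
by lra.
Qed.

End near_segment.
End multifunction_theory.

(** * Maximality of the sum under regularity *)

Lemma monotone_add_subdifferential (R : realType) (X : normedModType R)
    (T : X -> set (dual X)) (g : X -> R) :
  monotone_mf T -> monotone_mf (mf_add T (subdifferential g)).
Proof.
move=> /monotone_mfP mT; apply/monotone_mfP => y yt z zt [ys Ty [us gy <-]].
move=> [zs Tz [vs gz <-]]; rewrite opprD addrACA pairingDl addr_ge0//.
  exact: mT.
exact: subdifferential_monotone gy gz.
Qed.

Lemma maximal_add_subdifferential (R : realType) (X : normedModType R)
    (T : X -> set (dual X)) (g : X -> R) (lambda : R) :
  0 <= lambda -> convex_fun g -> lipschitz_fun lambda g ->
  maximal_monotone T -> regular_mf T ->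
  maximal_monotone (mf_add T (subdifferential g)).
Proof.
move=> l0 cg lg /maximal_monotoneP[mT maxT] rT; apply/maximal_monotoneP.
split; first exact: monotone_add_subdifferential.
move=> x xs xS; pose T' := shift_mf T x xs; pose G v := g (x + v).
have lG : lipschitz_fun lambda G.
  by move=> u v; rewrite (le_trans (lg _ _))// opprD addrACA subrr add0r.
have mT' : monotone_mf T' by exact: monotone_shift_mf.
have domT' (C : R) c cs : 0 <= C -> slope_bounded C c cs T' -> T' c !=set0.
  by move=> C0; exact: regular_shift_mf_nonempty.
(* Relatedness of [(x, xs)] to the sum is tested on one subgradient at [x + b]. *)
have T'G b bs : T' b bs ->
    exists2 zs, subdifferential G b zs & 0 <= '<< bs + zs, b >>.
  move=> Tb.
  have [zs gzs] := @subdifferential_nonempty R X g lambda (x + b) cg lg.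
  exists zs => [w|].
    by have := gzs (x + w); rewrite opprD addrACA subrr add0r.
  have -> : bs + zs = xs + bs + zs - xs.
    by rewrite -[xs + bs + zs]addrA [RHS]addrC addKr.
  have bE : b = x + b - x by rewrite addrC addKr.
  rewrite [X in '<< _, X >>]bE; apply: xS.
  by exists (xs + bs) => //; exists zs.
(* Subgradients are bounded by [lambda], so [T'G] bounds the slopes at (0, 0) by [lambda]. *)
have [as0 T0] : T' 0 !=set0.
  apply: (@domT' lambda 0 0) => // w ws Tw; rewrite subr0.
  have [zs Gzs] := T'G w ws Tw.
  have := lipschitz_subgradient_le w lG Gzs.
  by rewrite pairingDl pairingBl pairing0l => ? ?; lra.
(* Projecting [ys] away keeps the epigraph convex and lets one [zs] serve all its points. *)
pose K y q := exists ys, fitzpatrick_epi T' y q ys.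
have [|||zs gzs Kzs] := @subgradient_above R X g lambda x K cg lg.
- move=> t y q y' q' t01 [ys hy] [ys' hy'].
  by exists (t *: ys + (1 - t) *: ys'); exact: fitzpatrick_epi_convex.
- by exists as0; have := fitzpatrick_epi_graph mT' T0; rewrite pairing0r.
- move=> y q [ys hy]; have := fitzpatrick_epi_bound mT' domT' lG l0 T0 T'G hy.
  by rewrite /G addr0.
(* On the graph of [T], the inequality for [zs] says that [(x, xs - zs)] is monotonically related to
   [T]. *)
exists (xs - zs); last by exists zs => //; rewrite subrK.
apply: maxT => y ys Ty.
have T'y : T' (y - x) (ys - xs) by rewrite /T' /shift_mf /mkset !subrKC.
have /Kzs : K (y - x) '<< ys - xs, y - x >>.
  by exists (ys - xs); exact: fitzpatrick_epi_graph.
by rewrite !pairingBl => ?; lra.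
Qed.

(** * Regularity from maximality of the sums *)

Lemma regular_of_maximal_add (R : realType) (X : normedModType R)
    (T : X -> set (dual X)) : monotone_mf T ->
  (forall (x : X) (lambda : R), 0 < lambda ->
     maximal_monotone (mf_add T (subdifferential (scaled_dist lambda x)))) ->
  regular_mf T.
Proof.
move=> mT maxS x xs; apply/le_anti; rewrite L_mf_le_dist_dual//=.
apply/lee_addgt0Pr => e e0; have [->|Loo] := eqVneq (L_mf x xs T) +oo%E.
  by rewrite addye// leey.
have L0 : (0 <= L_mf x xs T)%E by rewrite /L_mf le_max lexx.
have LE : (fine (L_mf x xs T))%:E = L_mf x xs T.
  by rewrite fineK// ge0_fin_numE// lt_neqAle Loo leey.
rewrite -LE; set r := fine _; have r0 : 0 <= r by exact: fine_ge0.
(* The radius [r + e] serves as [lambda]; it is positive even when [L_mf] vanishes. *)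
have re0 : 0 < r + e by lra.
have /maximal_monotoneP[_ /(_ x xs)] := maxS x _ re0.
rewrite /mf_add /= => -[|ys Ty [zs gzs yzE]].
  (* Since [<zs, y - x>] equals [(r + e) * |y - x|], relatedness is exactly the slope bound. *)
  move=> y _ [ys Ty [zs gzs <-]].
  have /L_mf_leP/(_ y ys Ty) : (L_mf x xs T <= (r + e)%:E)%E.
    by rewrite -LE lee_fin -/r; lra.
  move: gzs; rewrite subdifferential_scaled_distE// => -[_].
  rewrite !pairingBl pairingDl => ? /(_ (ltW re0)); lra.
move: gzs; rewrite subdifferential_scaled_distE// => -[zs_le _].
apply: (@le_trans _ _ `|ys - xs|%:E).
  by apply: ereal_inf_lbound; exists ys.
by rewrite -yzE opprD addrA subrr add0r normrN -EFinD lee_fin.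
Qed.

Theorem theorem2 (R : realType) (X : completeNormedModType R)
    (T : X -> set (dual X)) (hT : maximal_monotone T) :
  regular_mf T <->
  (forall (x : X) (lambda : R), 0 < lambda ->
     maximal_monotone (mf_add T (subdifferential (scaled_dist lambda x)))).
Proof.
split=> [rT x lambda l0|]; last by apply: regular_of_maximal_add; case: hT.
apply: (@maximal_add_subdifferential _ _ _ _ lambda (ltW l0)) => //.
- exact/convex_scaled_dist/ltW.
- exact/lipschitz_scaled_dist/ltW.
Qed.
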